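(* The theory $T^*_{\mathit{feq}2}$ is $\mathrm{NSOP}_1$ but not simple.
   Context: Let $\mathcal{L}$ have two sorts $O$ (objects) and $P$ (parameters) and a ternary relation $E_z(x,y)$ on $O\times O\times P$. $T_{\mathit{feq}2}$ is the theory asserting that for each $z\in P$, $E_z(x,y)$ is an equivalence relation on $O$ all of whose classes have size exactly $2$. $T^*_{\mathit{feq}2}$ is the model completion of $T_{\mathit{feq}2}$ (equivalently the generic variation of the theory of an equivalence relation with infinitely many classes of size $2$); it is complete. *)

(* Defs.v *)
From Stdlib Require Import Classical.
From mathcomp Require Import all_boot.

Set Implicit Arguments.
Unset Strict Implicit.
Unset Printing Implicit Defensive.

(** * First-order logic in the two-sorted language [{E}] *)

Inductive sort := Obj | Par.

(** As usual in first-order logic, every sort of a structure is nonempty. *)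
Record structure := Structure {
  dom :> sort -> Type;
  interpE : dom Par -> dom Obj -> dom Obj -> Prop;
  dom_inhabited : forall s, inhabited (dom s)
}.

(** A set of variables is a sort-indexed family [V]; [ext V s] is [V] with one
    fresh variable of sort [s], so that binding is well-scoped by typing. *)
Inductive ext (V : sort -> Type) (s : sort) : sort -> Type :=
| new : ext V s s
| old : forall s', V s' -> ext V s s'.
Arguments new {V s}.
Arguments old {V s s'} _.

(** [formula V] is the type of formulas with free variables among [V]. *)
Inductive formula (V : sort -> Type) : Type :=
| Fls : formula V
| Eq : forall s, V s -> V s -> formula V
| E : V Par -> V Obj -> V Obj -> formula V
| Imp : formula V -> formula V -> formula V
| All : forall s, formula (ext V s) -> formula V.
Arguments Fls {V}.
Arguments All {V} s _.

Definition Neg (V : sort -> Type) (f : formula V) := Imp f Fls.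
Definition Or (V : sort -> Type) (f g : formula V) := Imp (Neg f) g.
Definition And (V : sort -> Type) (f g : formula V) := Neg (Imp f (Neg g)).
Definition Iff (V : sort -> Type) (f g : formula V) := And (Imp f g) (Imp g f).
Definition Ex (V : sort -> Type) s (f : formula (ext V s)) := Neg (All s (Neg f)).
Arguments Ex {V} s _.

Definition assignment (V : sort -> Type) (M : structure) := forall s, V s -> M s.

Definition extend (V : sort -> Type) (M : structure) (e : assignment V M) s (m : M s) :
    assignment (ext V s) M :=
  fun s' v => match v in ext _ _ s' return M s' with
              | new => m
              | old s' v => e s' v
              end.

Fixpoint sat (M : structure) (V : sort -> Type) (f : formula V) : assignment V M -> Prop :=
  match f with
  | Fls => fun _ => False
  | Eq s x y => fun e => e s x = e s y
  | E z x y => fun e => interpE (e Par z) (e Obj x) (e Obj y)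
  | Imp f g => fun e => sat f e -> sat g e
  | All s f => fun e => forall m : M s, sat f (extend e m)
  end.

Definition sentence := formula (fun _ => void).
Definition theory := sentence -> Prop.

Definition holds (M : structure) (f : sentence) := sat f (fun s => of_void (M s)).
Definition models (M : structure) (T : theory) := forall f, T f -> holds M f.

(** * Model completions *)

Definition embedding (M N : structure) (h : forall s, M s -> N s) :=
  (forall s, injective (h s)) /\
  (forall z x y, interpE (h Par z) (h Obj x) (h Obj y) <-> interpE z x y).

(** The models of [T'] together with the diagram of [M] are the models [N] of
    [T'] equipped with an embedding [h] of [M] in [N].  Taking [V := M], the
    sentences of the language with a name for each element of [M] are the
    [f : formula M], a name being interpreted in [N] through [h]. *)
Definition complete_with_diagram (T' : theory) (M : structure) :=
  forall f : formula M,
    (forall N (h : assignment M N), models N T' -> embedding h -> sat f h) \/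
    (forall N (h : assignment M N), models N T' -> embedding h -> ~ sat f h).

Definition model_completion (T T' : theory) :=
  [/\ forall M, models M T' -> models M T,
      forall M, models M T ->
        exists N (h : assignment M N), models N T' /\ embedding h
    & forall M, models M T -> complete_with_diagram T' M].

(** * Tree properties *)

(** A finite tuple of variables [x] is given by the number [n s] of its entries
    of each sort [s]; [formula (pair_vars n m)] is the type of partitioned
    formulas [phi(x; y)] with [x] of shape [n] and [y] of shape [m]. *)
Definition shape := sort -> nat.
Definition tup (M : structure) (n : shape) := forall s, 'I_(n s) -> M s.
Definition pair_vars (n m : shape) (s : sort) : Type := ('I_(n s) + 'I_(m s))%type.

Definition sat2 (M : structure) (n m : shape) (phi : formula (pair_vars n m))
    (b : tup M n) (a : tup M m) :=
  sat phi (fun s v => match v with inl i => b s i | inr j => a s j end).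

(** [{phi(x; a_i) | i}] is consistent, i.e. finitely satisfiable in [M]. *)
Definition consistent (M : structure) n m (phi : formula (pair_vars n m))
    (a : nat -> tup M m) :=
  forall F : seq nat, exists b : tup M n, forall i, i \in F -> sat2 phi b (a i).

Definition k_inconsistent (k : nat) (M : structure) n m
    (phi : formula (pair_vars n m)) (a : nat -> tup M m) :=
  forall F : seq nat, uniq F -> size F = k ->
    ~ exists b : tup M n, forall i, i \in F -> sat2 phi b (a i).

(** In both properties the tree of parameters is sought in an arbitrary model of
    [T]; for a complete [T] this amounts, by compactness, to seeking it in a
    monster model.  [mkseq eta i] is the restriction of the branch [eta] to
    [i]. *)
Definition has_SOP1 (T : theory) n m (phi : formula (pair_vars n m)) :=
  exists M : structure, models M T /\
  exists a : seq bool -> tup M m,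
    (forall eta : nat -> bool, consistent phi (fun i => a (mkseq eta i))) /\
    (forall eta nu : seq bool, prefix (rcons eta false) nu ->
       ~ exists b : tup M n, sat2 phi b (a nu) /\ sat2 phi b (a (rcons eta true))).

Definition NSOP1 (T : theory) :=
  forall n m (phi : formula (pair_vars n m)), ~ has_SOP1 T phi.

Definition has_TP (T : theory) n m (phi : formula (pair_vars n m)) :=
  exists M : structure, models M T /\
  exists (a : seq nat -> tup M m) (k : nat),
    [/\ 2 <= k,
        forall eta : nat -> nat, consistent phi (fun i => a (mkseq eta i))
      & forall eta : seq nat, k_inconsistent k phi (fun i => a (rcons eta i))].

Definition simple_theory (T : theory) :=
  forall n m (phi : formula (pair_vars n m)), ~ has_TP T phi.

(** * The theory [Tfeq2] *)

Local Notation v0 := new.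
Local Notation v1 := (old new).
Local Notation v2 := (old (old new)).
Local Notation v3 := (old (old (old new))).

(* Each axiom starts with "for all z of sort Par"; [v0] is the innermost bound
   variable.  The last one says that for all x there is y <> x such that, for
   all w, E_z(x,w) iff w = x or w = y. *)
Definition feq_refl : sentence := All Par (All Obj (E v1 v0 v0)).
Definition feq_sym : sentence :=
  All Par (All Obj (All Obj (Imp (E v2 v1 v0) (E v2 v0 v1)))).
Definition feq_trans : sentence :=
  All Par (All Obj (All Obj (All Obj
    (Imp (E v3 v2 v1) (Imp (E v3 v1 v0) (E v3 v2 v0)))))).
Definition feq_class2 : sentence :=
  All Par (All Obj (Ex Obj (And (Neg (Eq v0 v1))
    (All Obj (Iff (E v3 v2 v0) (Or (Eq v0 v2) (Eq v0 v1))))))).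

Definition Tfeq2 : theory := fun f =>
  f = feq_refl \/ f = feq_sym \/ f = feq_trans \/ f = feq_class2.

Lemma satAll M (V : sort -> Type) s (f : formula (ext V s)) (e : assignment V M) :
  sat (All s f) e <-> forall m : M s, sat f (extend e m).
Proof. by []. Qed.

Lemma satNeg M (V : sort -> Type) (f : formula V) (e : assignment V M) :
  sat (Neg f) e <-> ~ sat f e.
Proof. by []. Qed.

Lemma satOr M (V : sort -> Type) (f g : formula V) (e : assignment V M) :
  sat (Or f g) e <-> sat f e \/ sat g e.
Proof. by rewrite /=; tauto. Qed.

Lemma satAnd M (V : sort -> Type) (f g : formula V) (e : assignment V M) :
  sat (And f g) e <-> sat f e /\ sat g e.
Proof. by rewrite /=; tauto. Qed.

Lemma satIff M (V : sort -> Type) (f g : formula V) (e : assignment V M) :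
  sat (Iff f g) e <-> (sat f e <-> sat g e).
Proof. by rewrite /=; tauto. Qed.

Lemma satEx M (V : sort -> Type) s (f : formula (ext V s)) (e : assignment V M) :
  sat (Ex s f) e <-> exists m : M s, sat f (extend e m).
Proof.
split=> [H|[m Hm] H]; last exact: H m Hm.
by apply: NNPP => nex; apply: H => m Hm; apply: nex; exists m.
Qed.

Lemma models_Tfeq2 (M : structure) : models M Tfeq2 <->
  forall z : M Par,
    [/\ forall x, interpE z x x,
        forall x y, interpE z x y -> interpE z y x,
        forall x y w, interpE z x y -> interpE z y w -> interpE z x w
      & forall x, exists y, y <> x /\
          forall w, interpE z x w <-> w = x \/ w = y].
Proof.
split=> [H z|H f].
  split.
  - exact: (H feq_refl (or_introl erefl) z).
  - exact: (H feq_sym (or_intror (or_introl erefl)) z).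
  - exact: (H feq_trans (or_intror (or_intror (or_introl erefl))) z).
  move=> x.
  have H0 : holds M feq_class2 by apply: H; do 3!right.
  rewrite /holds /feq_class2 in H0.
  have H2 := proj1 (satAll _ _) (proj1 (satAll _ _) H0 z) x.
  have [y Hy] := proj1 (satEx _ _) H2.
  have [yx Hw] := proj1 (satAnd _ _ _) Hy.
  exists y; split=> // w.
  have Hi := proj1 (satIff _ _ _) (proj1 (satAll _ _) Hw w).
  have Ho := satOr (Eq v0 v2) (Eq v0 v1) (extend (extend (extend (extend
    (fun s => of_void (M s)) z) x) y) w).
  exact: iff_trans Hi Ho.
case=> [|[|[|]]] ->; [by move=> z; case: (H z).. |].
rewrite /holds /feq_class2.
apply: (proj2 (satAll _ _)) => z; apply: (proj2 (satAll _ _)) => x.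
have [_ _ _ /(_ x) [y [yx Hy]]] := H z.
apply: (proj2 (satEx _ _)); exists y.
apply: (proj2 (satAnd _ _ _)); split=> //.
apply: (proj2 (satAll _ _)) => w.
apply: (proj2 (satIff _ _ _)).
have Ho := satOr (Eq v0 v2) (Eq v0 v1) (extend (extend (extend (extend
  (fun s => of_void (M s)) z) x) y) w).
exact: iff_trans (Hy w) (iff_sym Ho).
Qed.

(* Main.v *)
(** Let T* be the model completion of Tfeq2.  A parameter z is nothing but a
fixed-point-free involution of the objects, its partner map, and by
the model completion axioms a formula transfers between any two models of T* sharing a
common submodel of Tfeq2.

NSOP1: given a tree [a] for phi in M, the pigeonhole principle yields nodes u_i
on one branch and siblings v_i off it such that phi(x; a_(v_i)) and
phi(x; a_(u_j)) are inconsistent for i <= j, while a_(u_i) and a_(v_i) satisfy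
the same first i equations between terms over the tree.  In three successive
ultrapowers take e realising phi(x; a_(u_i)) for all i, then d := lim a_(u_j),
then c0 := lim a_(u_i) and c1 := lim a_(v_i).  Over the substructure B generated
by the tree, c0 and c1 have isomorphic spans, and the spans of e, d and c0, and
of d and c1, pairwise meet in B because limits are finitely satisfiable in B.
Three copies of the last ultrapower can therefore be amalgamated so that one
element behaves towards c1 as e does towards c0, and towards d as e does.  By
the transfer property phi(x; c1) and phi(x; d) are jointly satisfiable, and Los's
theorem gives i <= j for which phi(x; a_(v_i)) and phi(x; a_(u_j)) are too.

Not simple: E_z(a_i, b_(i,j)), as a formula in z, has the tree property, since a
parameter may pair each a_i with any prescribed b_(i,j), but with only one. *)
From Stdlib Require Import ClassicalEpsilon PArith NArith.
From mathcomp Require Import all_boot.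
From mathcomp Require Import boolp classical_sets filter.
Require Import Defs.

Set Implicit Arguments.
Unset Strict Implicit.
Unset Printing Implicit Defensive.

(** * Renaming of variables and quantification over tuples *)

Definition rename_ext (V V' : sort -> Type) (r : forall s, V s -> V' s) s s'
    (v : ext V s s') : ext V' s s' :=
  match v with new => new | old _ w => old (r _ w) end.

Fixpoint rename (V V' : sort -> Type) (r : forall s, V s -> V' s) (f : formula V) :
    formula V' :=
  match f in formula _ return formula V' with
  | Fls => Fls
  | Eq s x y => Eq (r s x) (r s y)
  | E z x y => E (r _ z) (r _ x) (r _ y)
  | Imp f g => Imp (rename r f) (rename r g)
  | All s f => All s (rename (@rename_ext V V' r s) f)
  end.

Lemma sat_ext M (V : sort -> Type) (f : formula V) (e e' : assignment V M) :
  (forall s v, e s v = e' s v) -> sat f e <-> sat f e'.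
Proof.
move=> ee'; suff -> : e = e' by [].
by apply: functional_extensionality_dep => s; apply: functional_extensionality_dep.
Qed.

Lemma sat_rename M (V : sort -> Type) (f : formula V) (V' : sort -> Type)
    (r : forall s, V s -> V' s) (e : assignment V' M) :
  sat (rename r f) e <-> sat f (fun s v => e s (r s v)).
Proof.
elim: f V' r e => [{}V|{}V s x y|{}V z x y|{}V f IHf g IHg|{}V s f IHf] V' r e //=.
  by rewrite IHf IHg.
by split=> H m; have := H m; rewrite IHf; apply: (proj1 (sat_ext _ _)) => s' [].
Qed.

(** [Ex] binds only a fresh variable, so [r] first moves [v] there. The context of [g] remains [V],
    but the value at [v] no longer matters. *)
Lemma exists_quantified (V : sort -> Type) s (v : V s) (f : formula V) :
  exists g : formula V, forall M (e : assignment V M), sat g e <->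
    exists2 e', (forall s' (w : V s'), existT V s' w <> existT V s v -> e' s' w = e s' w)
      & sat f e'.
Proof.
have [r [r_v r_w]] : exists r : forall s', V s' -> ext V s s',
    r s v = new /\ forall s' w, existT V s' w <> existT V s v -> r s' w = old w.
  have r_ex (p : {s' & V s'}) : exists x : ext V s (tag p),
      (forall q : existT V s v = p, x = ecast q (ext V s (tag q)) q new) /\
      (p <> existT V s v -> x = old (tagged p)).
    have [q|pv] := pselect (existT V s v = p); last first.
      by exists (old (tagged p)); split=> // q; case: pv.
    exists (ecast q (ext V s (tag q)) q new); split=> [q'|/(_ (esym q))//].
    by rewrite (Prop_irrelevance q q').
  exists (fun s' w => projT1 (cid (r_ex (existT V s' w)))); split.
    by case: cid => x /= [/(_ erefl)].
  by move=> s' w; case: cid => x /= [_ H] /H.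
exists (Ex s (rename r f)) => M e; rewrite satEx; split=> [[m]|[e' e'e fe']].
  rewrite sat_rename => fm; exists (fun s' w => extend e m (r s' w)) => // s' w wv.
  by rewrite r_w.
exists (e' s v); rewrite sat_rename; move: fe'; apply: (proj1 (sat_ext _ _)) => s' w.
have [q|wv] := pselect (existT V s v = existT V s' w); last first.
  by rewrite r_w /= ?e'e // => q; apply: wv.
have H p (q' : existT V s v = p) :
    e' (tag p) (tagged p) = extend e (e' s v) (r (tag p) (tagged p)).
  by case: p / q'; rewrite /= r_v.
exact: (H _ q).
Qed.

Lemma exists_quantified_seq (V : sort -> Type) (l : seq {s & V s}) (f : formula V) :
  exists g : formula V, forall M (e : assignment V M), sat g e <->
    exists2 e', (forall s (w : V s), ~ List.In (existT V s w) l -> e' s w = e s w)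
      & sat f e'.
Proof.
elim: l => [|[s v] l [g gP]].
  exists f => M e; split=> [fe|[e' e'e]]; first by exists e.
  by apply: (proj1 (sat_ext _ _)) => s w; apply: e'e.
have [g' g'P] := exists_quantified v g; exists g' => M e; rewrite g'P.
split=> [[e1 e1e] /gP[e2 e2e1 fe2]|[e2 e2e fe2]].
  exists e2 => // s' w /= nin; rewrite e2e1 ?e1e // => H; apply: nin; first by left.
  by right.
pose e1 s' w := if pselect (existT V s' w = existT V s v) then e2 s' w else e s' w.
exists e1; first by move=> s' w; rewrite /e1; case: pselect.
apply/gP; exists e2 => // s' w nin; rewrite /e1; case: pselect => // ne.
by apply: e2e => /= -[/esym|].
Qed.

Definition join_assignment M (V V' : sort -> Type) (b : assignment V M)
    (a : assignment V' M) : assignment (fun s => (V s + V' s)%type) M :=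
  fun s v => match v with inl i => b s i | inr j => a s j end.

(** This turns joint satisfiability of several instances by one tuple into a formula, to which
    transfer between models applies. The block of [n] variables stays in the context with its value
    ignored. *)
Lemma exists_tuple (n : shape) (Y : sort -> Type)
    (f : formula (fun s => ('I_(n s) + Y s)%type)) :
  exists g : formula (fun s => ('I_(n s) + Y s)%type), forall M (b : tup M n) (a : assignment Y M),
    sat g (join_assignment b a) <-> exists b' : tup M n, sat f (join_assignment b' a).
Proof.
have In_enum (k : nat) (i : 'I_k) : List.In i (enum 'I_k).
  have : i \in enum 'I_k by rewrite mem_enum.
  by elim: (enum _) => //= j l IH; rewrite inE => /predU1P[->|/IH]; [left|right].
pose vars s := List.map (fun i : 'I_(n s) =>
  existT (fun s => ('I_(n s) + Y s)%type) s (inl i)) (enum 'I_(n s)).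
have [g gP] := exists_quantified_seq (vars Obj ++ vars Par) f.
exists g => M b a; rewrite gP; split=> [[e' e'e fe']|[b' fb']].
  exists (fun s i => e' s (inl i)); move: fe'; apply: (proj1 (sat_ext _ _)) => s [i|j] //=.
  rewrite e'e // => in_l.
  case: (List.in_app_or _ _ _ in_l) => in_vars;
    have [i [q _]] := proj1 (List.in_map_iff _ _ _) in_vars;
    by move: (congr1 (fun p => if projT2 p is inl _ then true else false) q).
exists (join_assignment b' a) => // s [i|j] //= nin; case: nin; apply: List.in_or_app.
by case: s i => i; [left|right]; apply: List.in_map.
Qed.

(** * Fixed-point-free involutions *)

(** Choice makes this a total function on any structure; it is the involution attached to [z] once
    the structure is a model of [Tfeq2]. *)
Definition partner (M : structure) (z : M Par) (x : M Obj) : M Obj :=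
  epsilon (inhabits x) (fun y => y <> x /\ interpE z x y).

Lemma partnerP M (TM : models M Tfeq2) (z : M Par) x :
  partner z x <> x /\ interpE z x (partner z x).
Proof.
have [_ _ _ /(_ x) [y [yx xP]]] := proj1 (models_Tfeq2 M) TM z.
apply: (epsilon_spec (inhabits x) (fun y => y <> x /\ interpE z x y)).
by exists y; split=> //; apply/xP; right.
Qed.

Lemma interpE_partner M (TM : models M Tfeq2) (z : M Par) x y :
  interpE z x y <-> y = x \/ y = partner z x.
Proof.
have [px xp] := partnerP TM z x.
have [_ _ _ /(_ x) [w [wx xP]]] := proj1 (models_Tfeq2 M) TM z.
by case/xP: (xp) => // ->.
Qed.

Lemma partner_unique M (TM : models M Tfeq2) (z : M Par) x y :
  y <> x -> interpE z x y -> y = partner z x.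
Proof. by move=> yx /(interpE_partner TM)[]. Qed.

Lemma partnerK M (TM : models M Tfeq2) (z : M Par) x : partner z (partner z x) = x.
Proof.
have [px xp] := partnerP TM z x; symmetry; apply: partner_unique => //.
  by move/esym.
by have [_ + _ _] := proj1 (models_Tfeq2 M) TM z; apply.
Qed.

Lemma embedding_partner (M N : structure) (TM : models M Tfeq2) (TN : models N Tfeq2)
    (h : forall s, M s -> N s) : embedding h ->
  forall z x, h _ (partner z x) = partner (h _ z) (h _ x).
Proof.
move=> [h_inj hE] z x; have [px xp] := partnerP TM z x.
by apply: partner_unique => //; [move/h_inj|apply/hE].
Qed.

Lemma partner_embedding (M N : structure) (TM : models M Tfeq2) (TN : models N Tfeq2)
    (h : forall s, M s -> N s) : (forall s, injective (h s)) ->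
  (forall z x, h _ (partner z x) = partner (h _ z) (h _ x)) -> embedding h.
Proof.
move=> h_inj hp; split=> // z x y; rewrite !interpE_partner // -hp.
by split=> -[] H; [left|right|left|right]; do ?apply: h_inj; rewrite // H.
Qed.

Lemma embedding_comp (M N P : structure) (h : forall s, M s -> N s) (k : forall s, N s -> P s) :
  embedding h -> embedding k -> embedding (fun s x => k s (h s x)).
Proof.
move=> [hi hE] [ki kE]; split=> [s x y /ki/hi //|z x y].
by rewrite kE hE.
Qed.

Lemma embedding_id (M : structure) : embedding (fun s (x : M s) => x).
Proof. by split=> [s x y|z x y]. Qed.

Definition involution_structure (D : sort -> Type) (p : D Par -> D Obj -> D Obj)
    (D_inh : forall s, inhabited (D s)) : structure :=
  @Structure D (fun z x y => y = x \/ y = p z x) D_inh.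

Lemma involution_structureP (D : sort -> Type) (p : D Par -> D Obj -> D Obj) D_inh :
  (forall z x, p z x <> x) -> (forall z x, p z (p z x) = x) ->
  models (involution_structure p D_inh) Tfeq2 /\
  forall z x, @partner (involution_structure p D_inh) z x = p z x.
Proof.
move=> px pK; have TM : models (involution_structure p D_inh) Tfeq2.
  apply/models_Tfeq2 => z; split=> /=.
  - by left.
  - by move=> x y [->|->]; [left|right; rewrite pK].
  - by move=> x y w [->|->] [->|->]; rewrite ?pK; tauto.
  - by move=> x; exists (p z x).
by split=> // z x; symmetry; apply: partner_unique => //; right.
Qed.

(** * Quotients and ultrapowers *)

(** Classes are handled through chosen representatives; an ultrapower consists of the sequences that
    represent their own class. *)
Definition canon (T : Type) (R : T -> T -> Prop) (x : T) : T :=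
  epsilon (inhabits x) (R x).

Definition equivalence_relation T (R : T -> T -> Prop) :=
  [/\ forall x, R x x, forall x y, R x y -> R y x
    & forall x y z, R x y -> R y z -> R x z].

Lemma canonP T (R : T -> T -> Prop) : equivalence_relation R ->
  forall x y, canon R x = canon R y <-> R x y.
Proof.
move=> [Rxx Rsym Rtrans] x y.
have canonR z : R z (canon R z) by apply: epsilon_spec; exists z.
split=> [xy|xy].
  by apply: Rtrans (canonR x) _; rewrite xy; apply: Rsym.
rewrite /canon (Prop_irrelevance (inhabits x) (inhabits y)).
suff -> : R x = R y by [].
by apply/funext => z; apply/propext; split; apply: Rtrans => //; apply: Rsym.
Qed.

Lemma free_ultrafilter_exists : exists U : set_system nat,
  UltraFilter U /\ forall n, U [set i | n <= i]%classic.
Proof.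
have [U [U_ultra sub_U]] := ultraFilterLemma eventually_filter.
by exists U; split=> // n; apply: sub_U; exists n.
Qed.

Definition omega_filter : set_system nat := projT1 (cid free_ultrafilter_exists).

#[local] Instance omega_ultra : UltraFilter omega_filter.
Proof. by rewrite /omega_filter; case: cid => U [UU Un] /=. Qed.

Lemma omega_eventually n : omega_filter [set i | n <= i]%classic.
Proof. by rewrite /omega_filter; case: cid => U [UU Un] /=. Qed.

#[local] Instance omega_proper : ProperFilter omega_filter.
Proof. exact: ultra_proper. Qed.

Lemma omegaS (P Q : nat -> Prop) :
  (forall i, P i -> Q i) -> omega_filter P -> omega_filter Q.
Proof. exact: filterS. Qed.

Lemma omegaI (P Q : nat -> Prop) :
  omega_filter P -> omega_filter Q -> omega_filter (fun i => P i /\ Q i).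
Proof. exact: filterI. Qed.

Lemma omegaT (P : nat -> Prop) : (forall i, P i) -> omega_filter P.
Proof. by move=> HP; apply: omegaS (omega_eventually 0) => i _. Qed.

Lemma omega_ex (P : nat -> Prop) : omega_filter P -> exists i, P i.
Proof.
move=> UP; apply: contrapT => nex; apply: (filter_not_empty omega_filter).
by apply: omegaS UP => i Pi; case: nex; exists i.
Qed.

Lemma omegaN (P : nat -> Prop) : omega_filter (fun i => ~ P i) <-> ~ omega_filter P.
Proof.
split=> [nP UP|nUP]; first by have [i []] := omega_ex (omegaI nP UP).
by have := @in_ultra_setVsetC _ _ P omega_ultra => -[].
Qed.

Lemma omega_imp (P Q : nat -> Prop) :
  omega_filter (fun i => P i -> Q i) <-> (omega_filter P -> omega_filter Q).
Proof.
split=> [PQ UP|PQ]; first by apply: omegaS (omegaI PQ UP) => i [].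
have [UP|/omegaN nP] := pselect (omega_filter P).
  by apply: omegaS (PQ UP) => i Qi.
by apply: omegaS nP => i nPi /nPi.
Qed.

Definition omega_eq (T : Type) (x y : nat -> T) := omega_filter (fun i => x i = y i).

Lemma omega_eq_equiv T : equivalence_relation (@omega_eq T).
Proof.
split=> [x|x y|x y z]; first exact: omegaT.
  by apply: omegaS => i.
by move=> xy yz; apply: omegaS (omegaI xy yz) => i [-> ->].
Qed.

Definition ultrapower_dom (T : Type) := {x : nat -> T | canon (@omega_eq T) x = x}.

Lemma canon_canon (T : Type) (x : nat -> T) :
  canon (@omega_eq T) (canon (@omega_eq T) x) = canon (@omega_eq T) x.
Proof.
apply/(canonP (@omega_eq_equiv T)); case: (@omega_eq_equiv T) => r s _; apply: s.
by apply: epsilon_spec; exists x.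
Qed.

Definition ulim (T : Type) (x : nat -> T) : ultrapower_dom T :=
  exist (fun x => canon (@omega_eq T) x = x) (canon (@omega_eq T) x) (canon_canon x).

Definition ultrapower (M : structure) : structure :=
  @Structure (fun s => ultrapower_dom (M s))
    (fun z x y => omega_filter (fun i => interpE (sval z i) (sval x i) (sval y i)))
    (fun s => let: inhabits x := dom_inhabited M s in inhabits (ulim (fun _ => x))).

Definition lim (M : structure) s (x : nat -> M s) : ultrapower M s := ulim x.

Lemma lim_eq (M : structure) s (x y : nat -> M s) :
  lim x = lim y <-> omega_filter (fun i => x i = y i).
Proof.
rewrite -[omega_filter _]/(omega_eq x y) -(canonP (@omega_eq_equiv (M s))).
by split=> [[]//|xy]; apply: eq_exist.
Qed.

Lemma sval_lim (M : structure) s (x : nat -> M s) :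
  omega_filter (fun i => sval (lim x) i = x i).
Proof.
apply/(canonP (@omega_eq_equiv (M s))); exact: canon_canon.
Qed.

Lemma lim_surj (M : structure) s (x : ultrapower M s) : exists y, x = lim y.
Proof. by case: x => x xP; exists x; apply: eq_exist. Qed.

Lemma lim_E (M : structure) (z : nat -> M Par) (x y : nat -> M Obj) :
  interpE (lim z) (lim x) (lim y) <-> omega_filter (fun i => interpE (z i) (x i) (y i)).
Proof.
have lims := omegaI (sval_lim z) (omegaI (sval_lim x) (sval_lim y)).
by split=> H; apply: omegaS (omegaI lims H) => i; rewrite /=; case=> -[-> [-> ->]].
Qed.

Theorem Los M (V : sort -> Type) (f : formula V) (e : nat -> assignment V M) :
  sat f (fun s v => lim (fun i => e i s v)) <-> omega_filter (fun i => sat f (e i)).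
Proof.
elim: f e => [{}V|{}V s x y|{}V z x y|{}V f IHf g IHg|{}V s f IHf] e /=.
- split=> // UF; by have [] := omega_ex UF.
- exact: lim_eq.
- exact: lim_E.
- by rewrite omega_imp IHf IHg.
have ext_lim (m : nat -> M s) :
    sat f (extend (fun s v => lim (fun i => e i s v)) (lim m)) <->
    omega_filter (fun i => sat f (extend (e i) (m i))).
  by rewrite -IHf; apply: sat_ext => s' [].
split=> [H|H m]; last first.
  have [m' ->] := lim_surj m; apply/ext_lim; exact: omegaS H.
apply: contrapT => /omegaN nH.
(* A counterexample is chosen at each index that has one, and the arbitrary [m0] elsewhere; the
   limit of these choices contradicts [H]. *)
have ex_m i : exists m : M s, ~ (forall m, sat f (extend (e i) m)) -> ~ sat f (extend (e i) m).
  have [m0] := dom_inhabited M s.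
  have [al|/existsNP[m nm]] := pselect (forall m, sat f (extend (e i) m)); last by exists m.
  by exists m0 => /(_ al).
have [m mP] := choice ex_m.
have [i [si /mP/(_ si)]] := omega_ex (omegaI (proj1 (ext_lim m) (H _)) nH); exact.
Qed.

Lemma ultrapower_models M (T : theory) : models M T -> models (ultrapower M) T.
Proof.
move=> TM f /TM fM; have := proj2 (Los f (fun _ s => of_void (M s))) (omegaT (fun _ => fM)).
by apply: (proj1 (sat_ext _ _)) => s [].
Qed.

Definition diag (M : structure) s (x : M s) : ultrapower M s := lim (fun _ => x).

Lemma diag_embedding (M : structure) : embedding (@diag M).
Proof.
split=> [s x y /lim_eq/omega_ex[]//|z x y]; rewrite lim_E.
by split=> [/omega_ex[]|H]//; apply: omegaT.
Qed.

Lemma partner_lim M (TM : models M Tfeq2) (z : nat -> M Par) (x : nat -> M Obj) :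
  partner (lim z) (lim x) = lim (fun i => partner (z i) (x i)).
Proof.
have pP i := partnerP TM (z i) (x i).
symmetry; apply: partner_unique; first exact: ultrapower_models.
  by move/lim_eq/omega_ex => [i]; case: (pP i).
by apply/lim_E/omegaT => i; case: (pP i).
Qed.

(** * Amalgamation *)

(** The involutions of the pieces induce a partial map [F] on classes. It is single-valued because
    gluing respects partners, and has no fixed point because gluing never identifies two elements of
    one piece; it only remains to make it total. *)
Lemma amalgamation (K : Type) (N : K -> structure)
    (R : forall s, {k & N k s} -> {k & N k s} -> Prop) :
  inhabited K -> (forall k, models (N k) Tfeq2) ->
  (forall s, equivalence_relation (@R s)) ->
  (forall s k (x y : N k s), R s (existT _ k x) (existT _ k y) -> x = y) ->
  (forall k l z z' x x', R Par (existT _ k z) (existT _ l z') ->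
     R Obj (existT _ k x) (existT _ l x') ->
     R Obj (existT _ k (partner z x)) (existT _ l (partner z' x'))) ->
  exists W, models W Tfeq2 /\ exists h : forall k s, N k s -> W s,
    (forall k, embedding (h k)) /\
    forall s k l (x : N k s) (y : N l s), R s (existT _ k x) (existT _ l y) ->
      h k s x = h l s y.
Proof.
move=> K_inh TN R_equiv R_inj R_partner.
pose cl s k (x : N k s) := canon (@R s) (existT _ k x).
have clP s k l (x : N k s) (y : N l s) :
    cl _ _ x = cl _ _ y <-> R s (existT _ k x) (existT _ l y).
  exact: canonP.
pose F w u v := exists k z x, [/\ w = cl Par k z, u = cl Obj k x & v = cl Obj k (partner z x)].
have F_fun w u v v' : F w u v -> F w u v' -> v = v'.
  move=> [k [z [x [-> -> ->]]]] [l [z' [x' [/clP zz' /clP xx' ->]]]].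
  exact/clP/R_partner.
have F_sym w u v : F w u v -> F w v u.
  by move=> [k [z [x [-> -> ->]]]]; exists k, z, (partner z x); rewrite partnerK.
have F_irrefl w u : ~ F w u u.
  move=> [k [z [x [_ -> /clP/R_inj]]]].
  by have [px _] := partnerP (TN k) z x; move/esym.
(* Doubling the objects leaves room for pairing each object on which no piece
   determines the involution with its own copy. *)
pose D s := match s with Obj => ({k & N k Obj} * bool)%type | Par => {k & N k Par} end.
pose p (w : D Par) (y : D Obj) : D Obj :=
  match pselect (exists v, F w y.1 v) with
  | left ex => (projT1 (cid ex), y.2)
  | right _ => (y.1, ~~ y.2)
  end.
have pF w u v b : F w u v -> p w (u, b) = (v, b).
  rewrite /p => Fwuv; case: pselect => [ex|[]]; last by exists v.
  by case: cid => v' /= /F_fun /(_ Fwuv) ->.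
have D_inh s : inhabited (D s).
  have [k] := K_inh; have [x] := dom_inhabited (N k) s; constructor.
  by case: s x => x; [exact: (existT _ k x, false)|exact: (existT _ k x)].
have p_neq w y : p w y <> y.
  case: y => u b; rewrite /p; case: pselect => [ex|_] /=; last by case; case: (b).
  by case: cid => v /= Fv [vu]; move: Fv; rewrite vu; apply: F_irrefl.
have pK w y : p w (p w y) = y.
  case: y => u b; rewrite {2}/p; case: pselect => [ex|nex] /=.
    by case: cid => v /= /F_sym; apply: pF.
  by rewrite /p /=; case: pselect => //= _; rewrite negbK.
have [TW pW] := involution_structureP D_inh p_neq pK.
exists (involution_structure p D_inh); split=> //.
pose h k s : N k s -> D s :=
  match s with Obj => fun x => (cl Obj k x, false) | Par => fun z => cl Par k z end.
exists h; split=> [k|[] k l x y /clP //=]; last by rewrite /h => ->.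
apply: partner_embedding => //.
  by move=> [] x y; rewrite /h; [case=> /clP|move/clP]; apply: R_inj.
by move=> z x; rewrite pW; symmetry; apply: pF; exists k, z, x.
Qed.

(** * Binary trees *)

Lemma prefix_nth (s t : seq bool) n : prefix s t -> n < size s -> nth false t n = nth false s n.
Proof. by case/prefixP => w -> ns; rewrite nth_cat ns. Qed.

(** Pigeonhole: [c] takes 2^i + 1 values, while the first [i] predicates have only 2^i patterns of
    truth values. *)
Lemma agreeing_siblings (P : nat -> seq bool -> Prop) i (eta : seq bool) :
  exists ab : nat * nat, ab.1 < ab.2 /\ forall k, k < i ->
    P k (eta ++ nseq ab.2 false ++ [:: true]) <-> P k (eta ++ nseq ab.1 false ++ [:: true]).
Proof.
pose node c := eta ++ nseq c false ++ [:: true].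
pose vec (c : 'I_(2 ^ i).+1) := [ffun k : 'I_i => `[< P k (node c) >]].
have : ~~ injectiveb vec.
  apply/negP => /injectiveP/leq_card.
  by rewrite card_ord card_ffun card_bool card_ord ltnn.
move=> /injectivePn[c [d cd vcd]].
have agree k : k < i -> P k (node c) <-> P k (node d).
  move=> ki; move/ffunP/(_ (Ordinal ki)): vcd; rewrite !ffunE /= => e.
  by split=> /asboolP H; apply/asboolP; [rewrite -e|rewrite e].
have [lt|lt|/val_inj e] := ltngtP c d; last by rewrite e eqxx in cd.
  by exists (c : nat, d : nat); split=> // k ki; exact: iff_sym (agree k ki).
by exists (d : nat, c : nat); split=> // k ki; exact: agree.
Qed.

(** From [w i], the branch goes on through the node with more zeros, while [v i] is the agreeing
    node with fewer zeros. Hence [v i] turns to [true] where the branch still follows [false]. *)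
Lemma tree_sequence (P : nat -> seq bool -> Prop) : exists u v : nat -> seq bool,
  [/\ exists eta, forall i, exists n, u i = mkseq eta n,
      forall i j, i <= j ->
        exists2 xi, v i = rcons xi true & prefix (rcons xi false) (u j)
    & forall k i, k < i -> P k (u i) <-> P k (v i)].
Proof.
have [ab abP] := choice (fun p : nat * seq bool => @agreeing_siblings P p.1 p.2).
pose node eta c := eta ++ nseq c false ++ [:: true].
pose w := fix w i := if i is i'.+1 then node (w i') (ab (i', w i')).2 else [::].
have pre_w i j : i <= j -> prefix (w i) (w j).
  elim: j => [|j IH]; first by rewrite leqn0 => /eqP->.
  rewrite leq_eqVlt => /predU1P[->|]; first exact: prefix_refl.
  by rewrite ltnS => /IH pre; apply: prefix_trans pre _; apply: prefix_prefix.
have size_w i : i <= size (w i).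
  elim: i => // i IH; rewrite /= !size_cat /= addnA addn1 ltnS.
  exact: leq_trans IH (leq_addr _ _).
exists (fun i => w i.+1), (fun i => node (w i) (ab (i, w i)).1); split.
(* By [size_w] the node [w n.+1] has more than [n] bits, and the nodes are nested, so its bit [n] is
   that of the whole branch. *)
- exists (fun n => nth false (w n.+1) n) => i; exists (size (w i.+1)).
  apply: (@eq_from_nth _ false); rewrite ?size_mkseq // => n ni.
  rewrite nth_mkseq //; have [/pre_w pre|/ltnW/pre_w pre] := leqP n.+1 i.+1.
    exact: prefix_nth pre (size_w n.+1).
  by rewrite (prefix_nth pre).
- move=> i j ij; exists (w i ++ nseq (ab (i, w i)).1 false).
    by rewrite -cats1 -catA.
  apply: prefix_trans (pre_w i.+1 j.+1 ij); rewrite /= /node rcons_cat prefix_catr // eqxx /=.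
  have [lt _] := abP (i, w i).
  rewrite -(subnKC lt) nseqD -catA; apply/prefixP; eexists.
  by congr (_ ++ _); elim: (ab _).1 => //= c <-.
- by move=> k i ki; have [_] := abP (i, w i); apply.
Qed.

(** * Independence in the model completion *)

(** Putting the elements [e] for the variables of [f] gives a sentence with names from [M], which
    [T'] with the diagram of [M] decides alike in [N] and [N']. *)
Lemma model_completion_elementary (T' : theory) (mc : model_completion Tfeq2 T')
    (M N N' : structure) (h : assignment M N) (h' : assignment M N') :
  models M Tfeq2 -> models N T' -> models N' T' -> embedding h -> embedding h' ->
  forall (V : sort -> Type) (f : formula V) (e : assignment V M),
    sat f (fun s v => h s (e s v)) <-> sat f (fun s v => h' s (e s v)).
Proof.
move=> TM TN TN' hh hh' V f e; rewrite -(sat_rename f e h) -(sat_rename f e h').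
have [_ _ /(_ M TM (rename e f))[H|H]] := mc; last by split=> /H; tauto.
by split=> _; apply: H.
Qed.

Inductive piece := Center | Left | Right.

(* Over the base [B], the copies [Center], [Left] and [Right] of [N] are glued
   along [sg] between [Left] and [Center], along [C] between [Left] and [Right]
   and along [A] between [Center] and [Right]. *)
Lemma independence_theorem (T' : theory) (mc : model_completion Tfeq2 T') (N : structure)
    (B C A : forall s, N s -> Prop) (sg : forall s, N s -> N s -> Prop)
    (n m : shape) (phi : formula (pair_vars n m)) (e : tup N n) (c0 c1 c2 : tup N m) :
  models N T' ->
  (forall z x, A Par z -> A Obj x -> A Obj (partner z x)) ->
  (forall z x, C Par z -> C Obj x -> C Obj (partner z x)) ->
  (forall z z' x x', sg Par z z' -> sg Obj x x' -> sg Obj (partner z x) (partner z' x')) ->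
  (forall s x x' y y', sg s x y -> sg s x' y' -> x = x' <-> y = y') ->
  (forall s x, B s x -> [/\ A s x, C s x & sg s x x]) ->
  (forall s x y, sg s x y -> C s x -> B s x) ->
  (forall s x y, sg s x y -> A s y -> B s y) ->
  (forall s x, C s x -> A s x -> B s x) ->
  (forall s i, C s (e s i)) -> (forall s i, sg s (c0 s i) (c1 s i)) ->
  (forall s i, A s (c2 s i)) ->
  sat2 phi e c0 -> sat2 phi e c2 ->
  exists b : tup N n, sat2 phi b c1 /\ sat2 phi b c2.
Proof.
move=> T'N A_cl C_cl sg_cl sg_inj B_sub sgC sgA CA Ce sgc Ac2 fc0 fc2.
have [T'T T_ext _] := mc; have TN := T'T N T'N.
pose glue k l s (x y : N s) : Prop := match k, l with
  | Center, Left => sg s y x | Left, Center => sg s x y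
  | Center, Right | Right, Center => x = y /\ A s x
  | Left, Right | Right, Left => x = y /\ C s x
  | _, _ => x = y
  end.
pose R s (p q : {k : piece & N s}) := glue (projT1 p) (projT1 q) s (projT2 p) (projT2 q).
have R_equiv s : equivalence_relation (@R s).
  rewrite /R /glue; split.
  - by move=> [[] x].
  - by move=> [[] x] [[] y] //=; case=> ->.
  move=> [k x] [l y] [j w] /=.
  have fun1 x1 x2 x3 : sg s x1 x2 -> sg s x1 x3 -> x2 = x3.
    by move=> H1 H2; apply: (proj1 (sg_inj _ _ _ _ _ H1 H2)).
  have fun2 x1 x2 x3 : sg s x2 x1 -> sg s x3 x1 -> x2 = x3.
    by move=> H1 H2; apply: (proj2 (sg_inj _ _ _ _ _ H1 H2)).
  (* For transitivity across three distinct copies: an element lying in two of the overlaps lies in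
     [B], where [sg] is the identity and all gluings agree. *)
  have sgC' x1 x2 : sg s x1 x2 -> C s x1 -> x2 = x1 /\ A s x1.
    by move=> H /(sgC _ _ _ H)/B_sub[a c H']; split=> //; apply: fun1 H'.
  have sgA' x1 x2 : sg s x1 x2 -> A s x2 -> x1 = x2 /\ C s x2.
    by move=> H /(sgA _ _ _ H)/B_sub[a c H']; split=> //; apply: fun2 H'.
  have CA' x1 : C s x1 -> A s x1 -> sg s x1 x1.
    by move=> Cx Ax; have [] := B_sub _ _ (CA _ _ Cx Ax).
  case: k l j => -[] [] //=; do ?[by move=> -> | by move=> + <-
    | by move=> [-> ?] | by move=> ? [<-]
    | exact: fun1 | by move=> ? ?; apply: fun2; eassumption].
  - by move=> H [<- /(sgC' _ _ H)[-> ?]].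
  - by move=> [-> _] [-> _].
  - by move=> [-> Ay] [<- Cy]; apply: CA'.
  - by move=> H [<- /(sgA' _ _ H)[-> ?]].
  - by move=> [-> Cy] [<- Ay]; apply: CA'.
  - by move=> [-> _] [-> _].
  - by move=> [-> Ay] /[dup] H /sgA'/(_ Ay)[-> ?].
  - by move=> [-> _] [-> _].
  - by move=> [-> Cy] /[dup] H /sgC'/(_ Cy)[-> ?].
  - by move=> [-> _] [-> _].
have [W [TW [h [h_emb h_glue]]]] : exists W, models W Tfeq2 /\
    exists h : forall (k : piece) s, N s -> W s, (forall k, embedding (h k)) /\
    forall s k l (x y : N s), glue k l s x y -> h k s x = h l s y.
  have R_inj s k (x y : N s) : R s (existT _ k x) (existT _ k y) -> x = y by case: k.
  have R_partner k l (z z' : N Par) (x x' : N Obj) :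
      R Par (existT _ k z) (existT _ l z') -> R Obj (existT _ k x) (existT _ l x') ->
      R Obj (existT _ k (partner z x)) (existT _ l (partner z' x')).
    rewrite /R; case: k l => -[] //=; do ?[by move=> -> -> | exact: sg_cl];
      by move=> [-> ?] [-> ?]; split=> //; (apply: A_cl || apply: C_cl).
  have [W [TW [h [h_emb h_glue]]]] := @amalgamation piece (fun _ => N) R (inhabits Center)
    (fun _ => TN) R_equiv R_inj R_partner.
  by exists W; split=> //; exists h; split=> // s k l x y; apply: h_glue.
have [W' [j [T'W j_emb]]] := T_ext W TW.
have jh_emb k := embedding_comp (h_emb k) j_emb.
(* All three embeddings of [N] in [W'] are elementary, by comparison with the identity of [N]. *)
have elem k V (f : formula V) (a : assignment V N) :
    sat f a <-> sat f (fun s v => j s (h k s (a s v))).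
  exact: (model_completion_elementary mc TN T'N T'W (embedding_id N) (jh_emb k)).
pose phi1 := rename (fun s (v : pair_vars n m s) => match v with
  inl i => inl i | inr l => inr (inl l) end : 'I_(n s) + ('I_(m s) + 'I_(m s)))%type phi.
pose phi2 := rename (fun s (v : pair_vars n m s) => match v with
  inl i => inl i | inr l => inr (inr l) end : 'I_(n s) + ('I_(m s) + 'I_(m s)))%type phi.
have phiP P (b : tup P n) (d1 d2 : tup P m) :
    sat (And phi1 phi2) (join_assignment b (join_assignment d1 d2)) <->
    sat2 phi b d1 /\ sat2 phi b d2.
  rewrite satAnd !sat_rename /sat2.
  by split=> -[H1 H2]; split; [move: H1|move: H2|move: H1|move: H2];
    apply: (proj1 (sat_ext _ _)) => s [].
have [g gP] := exists_tuple (And phi1 phi2).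
(* The tuple [e] is a placeholder in the block that [g] ignores. The claim about [c1] and [c2] is
   moved to their [Center] copies in [W']. *)
have /gP[b /phiP] : sat g (join_assignment e (join_assignment c1 c2)); last by exists b.
apply/(elem Center).
pose jh k d (x : tup N d) : tup W' d := fun s i => j s (h k s (x s i)).
apply: (proj1 (@sat_ext _ _ g (join_assignment (jh Center n e)
    (join_assignment (jh Center m c1) (jh Center m c2))) _ _)).
  by move=> s [|[]].
(* The witness is the [Left] copy of [e]. The [Left] copy of [c0] is the [Center] copy of [c1] by
   [sg]; the [Right] copy of [e] is its [Left] copy by [C], and the [Right] copy of [c2] is its
   [Center] copy by [A]. *)
apply/gP; exists (jh Left n e); apply/phiP; split.
  move/(elem Left): fc0; apply: (proj1 (sat_ext _ _)) => s [i|i] //=.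
  by congr j; apply: h_glue; apply: sgc.
move/(elem Right): fc2; apply: (proj1 (sat_ext _ _)) => s [i|i] /=.
  by congr j; apply: h_glue; split; last exact: Ce.
by congr j; apply: h_glue; split; last exact: Ac2.
Qed.

(** * Terms *)

(* [(x, [:: z1; ...; zk])] stands for the image of [x] under the involutions of
   zk, ..., z1. *)
Definition term (V : sort -> Type) (s : sort) : Type :=
  match s with Obj => (V Obj * seq (V Par))%type | Par => V Par end.

Definition eval M (V : sort -> Type) (g : assignment V M) (s : sort) : term V s -> M s :=
  match s return term V s -> M s with
  | Obj => fun t => foldr (fun z x => partner (g Par z) x) (g Obj t.1) t.2
  | Par => fun z => g Par z
  end.

Definition term_rename (V V' : sort -> Type) (r : forall s, V s -> V' s) (s : sort) :
    term V s -> term V' s :=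
  match s return term V s -> term V' s with
  | Obj => fun t => (r Obj t.1, map (r Par) t.2)
  | Par => r Par
  end.

(** The substructure generated by [g]. The partner operation takes values among objects only, so the
    parameters in it are just those of [g]. *)
Definition span M (V : sort -> Type) (g : assignment V M) (s : sort) (x : M s) : Prop :=
  exists t, x = eval g t.

Definition term_var (V : sort -> Type) (s : sort) : V s -> term V s :=
  match s return V s -> term V s with Obj => fun v => (v, [::]) | Par => id end.

Lemma eval_var M (V : sort -> Type) (g : assignment V M) s (v : V s) :
  eval g (term_var v) = g s v.
Proof. by case: s v. Qed.

Lemma span_gen M (V : sort -> Type) (g : assignment V M) s v : span g (g s v).
Proof. by exists (term_var v); rewrite eval_var. Qed.

Lemma span_partner M (V : sort -> Type) (g : assignment V M) (z : M Par) (x : M Obj) :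
  span g z -> span g x -> span g (partner z x).
Proof. by move=> [t ->] [t' ->]; exists (t'.1, t :: t'.2). Qed.

Lemma span_eval M (V V' : sort -> Type) (g : assignment V M) (g' : assignment V' M)
    s (t : term V' s) :
  (forall s' v, span g (g' s' v)) -> span g (eval g' t).
Proof.
move=> gg'; case: s t => [[x w]|z] //=.
by elim: w => [|z w IH] //=; apply: span_partner.
Qed.

Lemma eval_ext M (V : sort -> Type) (g g' : assignment V M) s (t : term V s) :
  (forall s v, g s v = g' s v) -> eval g t = eval g' t.
Proof.
by move=> gg'; case: s t => [[x w]|z] //=; elim: w => [|z w IH] //=; rewrite gg' IH.
Qed.

Lemma eval_rename M (V V' : sort -> Type) (r : forall s, V s -> V' s) (g : assignment V' M)
    s (t : term V s) :
  eval g (term_rename r t) = eval (fun s v => g s (r s v)) t.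
Proof. by case: s t => [[x w]|z] //=; rewrite foldr_map. Qed.

Lemma eval_embedding (M N : structure) (h : forall s, M s -> N s) (V : sort -> Type)
    (g : assignment V M) s (t : term V s) :
  models M Tfeq2 -> models N Tfeq2 -> embedding h ->
  eval (fun s v => h s (g s v)) t = h s (eval g t).
Proof.
move=> TM TN hh; case: s t => [[x w]|z] //=.
by elim: w => [|z w IH] //=; rewrite IH (embedding_partner TM TN hh).
Qed.

Lemma eval_lim M (V : sort -> Type) (g : nat -> assignment V M) s (t : term V s) :
  models M Tfeq2 ->
  eval (fun s v => lim (fun i => g i s v)) t = lim (fun i => eval (g i) t).
Proof.
move=> TM; case: s t => [[x w]|z] //=.
by elim: w => [|z w IH] //=; rewrite IH partner_lim.
Qed.

Definition tuple_lim M (n : shape) (b : nat -> tup M n) : tup (ultrapower M) n :=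
  fun s i => lim (fun k => b k s i).

Definition tuple_diag M (n : shape) (b : tup M n) : tup (ultrapower M) n :=
  fun s i => diag (b s i).

Lemma sat2_lim M n m (phi : formula (pair_vars n m)) (b : nat -> tup M n) (c : nat -> tup M m) :
  sat2 phi (tuple_lim b) (tuple_lim c) <-> omega_filter (fun k => sat2 phi (b k) (c k)).
Proof. by rewrite -Los; apply: sat_ext => s []. Qed.

Lemma tuple_lim_surj M n (b : tup (ultrapower M) n) : exists b', b = tuple_lim b'.
Proof.
exists (fun k s i => sval (b s i) k).
apply: functional_extensionality_dep => s; apply: functional_extensionality_dep => i.
rewrite /tuple_lim; have [x ->] := lim_surj (b s i).
by apply/lim_eq; apply: omegaS (sval_lim x).
Qed.

(* The variables [(Some nu, i)] name the entries of the tuple at the node [nu]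
   of a tree, the variables [(None, i)] those of one further tuple. *)
Definition node_vars (m : shape) (s : sort) : Type := (option (seq bool) * 'I_(m s))%type.

Definition node_assignment M m (a : seq bool -> tup M m) (c : tup M m) :
    assignment (node_vars m) M :=
  fun s v => if v.1 is Some nu then a nu s v.2 else c s v.2.

Definition tree_vars (m : shape) (s : sort) : Type := (seq bool * 'I_(m s))%type.

Definition tree_assignment M m (a : seq bool -> tup M m) : assignment (tree_vars m) M :=
  fun s v => a v.1 s v.2.

(** There are countably many equations between terms; applying [tree_sequence] to an enumeration of
    them makes each one agree at [u i] and [v i] for all large [i]. *)
Lemma indiscernible_siblings M m (a : seq bool -> tup M m) : exists u v : nat -> seq bool,
  [/\ exists eta, forall i, exists n, u i = mkseq eta n,
      forall i j, i <= j ->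
        exists2 xi, v i = rcons xi true & prefix (rcons xi false) (u j)
    & forall s (t t' : term (node_vars m) s), omega_filter (fun i =>
        eval (node_assignment a (a (u i))) t = eval (node_assignment a (a (u i))) t' <->
        eval (node_assignment a (a (v i))) t = eval (node_assignment a (a (v i))) t')].
Proof.
pose tObj := ((option (seq bool) * 'I_(m Obj)) * seq (option (seq bool) * 'I_(m Par)))%type.
pose tPar := (option (seq bool) * 'I_(m Par))%type.
pose holds_at s (t t' : term (node_vars m) s) nu :=
  eval (node_assignment a (a nu)) t = eval (node_assignment a (a nu)) t'.
pose P k nu := match unpickle k : option ((tObj * tObj) + (tPar * tPar)) with
  | Some (inl c) => @holds_at Obj c.1 c.2 nu
  | Some (inr c) => @holds_at Par c.1 c.2 nu
  | None => True
  end.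
have [u [v [branch sib uv]]] := tree_sequence P; exists u, v; split=> // s t t'.
have [k kP] : exists k, forall nu, P k nu = @holds_at s t t' nu.
  rewrite /P; case: s t t' => t t'.
    by exists (pickle (inl (t, t') : (tObj * tObj) + (tPar * tPar))%type) => nu; rewrite pickleK.
  by exists (pickle (inr (t, t') : (tObj * tObj) + (tPar * tPar))%type) => nu; rewrite pickleK.
by apply: omegaS (omega_eventually k.+1) => i /uv; rewrite !kP.
Qed.

(** * The tree properties *)

Theorem NSOP1_model_completion (T' : theory) : model_completion Tfeq2 T' -> NSOP1 T'.
Proof.
move=> mc n m phi [M [T'M [a [cons incons]]]].
have [T'T _ _] := mc; have TM := T'T M T'M.
have [u [v [[eta branch] sib uv]]] := indiscernible_siblings a.
(* The nodes [u i] lie on one branch, so consistency along it applies to each initial segment of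
   them. *)
have ex_b k : exists b : tup M n, forall i, i <= k -> sat2 phi b (a (u i)).
  have [d dP] := choice branch.
  have [b bP] := cons eta [seq d i | i <- iota 0 k.+1].
  exists b => i ik; rewrite dP; apply: bP; apply: map_f.
  by rewrite mem_iota.
have [b bP] := choice ex_b.
(* The realisation [e1] lives in [N1], the limit [d] in [N2], and [c0], [c1] in [N3]; a final digit
   on [a] or [e] tells in which ultrapower the copy is taken. *)
pose N1 := ultrapower M; pose N2 := ultrapower N1; pose N3 := ultrapower N2.
have T'N1 : models N1 T' := ultrapower_models T'M.
have T'N2 : models N2 T' := ultrapower_models T'N1.
have T'N3 : models N3 T' := ultrapower_models T'N2.
have TN1 := T'T _ T'N1; have TN2 := T'T _ T'N2; have TN3 := T'T _ T'N3.
pose a1 nu := tuple_diag (a nu); pose a2 nu := tuple_diag (a1 nu).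
pose a3 nu := tuple_diag (a2 nu).
pose e1 := tuple_lim b.
have e1P i : sat2 phi e1 (a1 (u i)).
  apply/(sat2_lim phi b (fun _ => a (u i))).
  by apply: omegaS (omega_eventually i) => k; apply: bP.
pose d := tuple_lim (fun j => a1 (u j)).
pose e2 := tuple_diag e1; pose e3 := tuple_diag e2.
pose c0 := tuple_lim (fun i => a2 (u i)); pose c1 := tuple_lim (fun i => a2 (v i)).
have e2P i : sat2 phi e2 (a2 (u i)).
  by apply/(sat2_lim phi (fun _ => e1) (fun _ => a1 (u i)))/omegaT.
have e2d : sat2 phi e2 d by apply/(sat2_lim phi (fun _ => e1) _)/omegaT.
have e3c0 : sat2 phi e3 c0 by apply/(sat2_lim phi (fun _ => e2) _)/omegaT.
have e3d : sat2 phi e3 (tuple_diag d).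
  by apply/(sat2_lim phi (fun _ => e2) (fun _ => d))/omegaT.
pose B1 := span (tree_assignment a1); pose B2 := span (tree_assignment a2).
pose B s (x : N3 s) := exists2 y, @B1 s y & x = diag (diag y).
have B2B s y : B2 s y -> B s (diag y).
  move=> [t ->]; exists (eval (tree_assignment a1) t); first by exists t.
  by rewrite -(eval_embedding _ _ TN1 TN2 (diag_embedding N1)).
pose sg s x y := exists t : term (node_vars m) s,
  x = eval (node_assignment a3 c0) t /\ y = eval (node_assignment a3 c1) t.
(* Instead of the spans of [d] and [e3] over the tree, larger sets are used: [A] holds all limits of
   sequences from the tree span, and [C] is the whole copy of [N1]. *)
pose A s (x : N3 s) := exists2 y : nat -> N1 s, (forall i, B1 s (y i)) & x = diag (lim y).
pose C s (x : N3 s) := exists y : N1 s, x = diag (diag y).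
have node_lim w s (t : term (node_vars m) s) :
    eval (node_assignment a3 (tuple_lim (fun i => a2 (w i)))) t =
    lim (fun i => eval (node_assignment a2 (a2 (w i))) t).
  by rewrite -eval_lim //; apply: eval_ext => s' [[nu|] i].
have node_B2 nu s (t : term (node_vars m) s) : B2 s (eval (node_assignment a2 (a2 nu)) t).
  by apply: span_eval => s' [[xi|] i]; [apply: (span_gen _ (xi, i))|apply: (span_gen _ (nu, i))].
have node_M nu s (t : term (node_vars m) s) :
    eval (node_assignment a2 (a2 nu)) t = diag (diag (eval (node_assignment a (a nu)) t)).
  rewrite -(eval_embedding _ _ TM TN1 (diag_embedding M)).
  rewrite -(eval_embedding _ _ TN1 TN2 (diag_embedding N1)).
  by apply: eval_ext => s' [[xi|] i].
have diag_inj P s (x y : dom P s) : diag x = diag y -> x = y.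
  by have [inj _] := diag_embedding P; apply: inj.
have [b3 [b3c1 b3d]] : exists b : tup N3 n, sat2 phi b c1 /\ sat2 phi b (tuple_diag d).
  apply: (independence_theorem mc (B := B) (C := C) (A := A) (sg := sg) T'N3
    _ _ _ _ _ _ _ _ _ _ _ e3c0 e3d).
  - move=> z x [z' Bz' ->] [x' Bx' ->]; exists (fun i => partner (z' i) (x' i)).
      by move=> i; exact: span_partner (Bz' i) (Bx' i).
    by rewrite -(embedding_partner TN2 TN3 (diag_embedding N2)) partner_lim.
  - move=> z x [z' ->] [x' ->]; exists (partner z' x').
    rewrite -(embedding_partner TN2 TN3 (diag_embedding N2)).
    by rewrite -(embedding_partner TN1 TN2 (diag_embedding N1)).
  - by move=> z z' x x' [t [-> ->]] [t' [-> ->]]; exists (t'.1, t :: t'.2).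
  (* An equation at [c0] holds when it holds at [u i] for almost all [i], and likewise for [c1] and
     [v i]; [uv] compares the two. *)
  - move=> s x x' y y' [t [-> ->]] [t' [-> ->]]; rewrite !node_lim !lim_eq.
    split; move/(omegaI (uv s t t')); apply: omegaS => i; rewrite !node_M => -[uvi];
      by move=> /diag_inj/diag_inj/uvi->.
  - move=> s x [y B1y ->]; split; [by exists (fun _ => y)|by exists y|].
    have [t ->] := B1y; exists (term_rename (fun s v => (Some v.1, v.2)) t).
    rewrite !eval_rename -(eval_embedding _ _ TN1 TN2 (diag_embedding N1)).
    by rewrite -(eval_embedding _ _ TN2 TN3 (diag_embedding N2)).
  (* A limit of elements of the tree span that equals a diagonal element equals it at some index, so
     that element is already in the tree span. The next two intersections are treated alike. *)
  - move=> s x y [t [-> _]] [w e]; rewrite e; apply: B2B.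
    move: e; rewrite node_lim => /lim_eq/omega_ex[i <-]; exact: node_B2.
  - move=> s x y [t [_ ->]] [w _ e]; rewrite e; apply: B2B.
    move: e; rewrite node_lim => /lim_eq/omega_ex[i <-]; exact: node_B2.
  - move=> s x [y ->] [w B1w /diag_inj/lim_eq/omega_ex[i yi]].
    by exists y; rewrite // yi.
  - by move=> s i; exists (e1 s i).
  - by move=> s i; exists (term_var (None, i)); rewrite !eval_var.
  - move=> s i; exists (fun j => a1 (u j) s i) => // j.
    exact: (span_gen (tree_assignment a1) (u j, i)).
(* The ultrapowers are undone from the outermost: first [c1] becomes [v i], then [d] becomes [u j]
   with [j] at least [i], and finally the realising tuple descends to [M]. *)
have [b2 b2E] := tuple_lim_surj b3; rewrite b2E in b3c1 b3d.
move/(sat2_lim phi b2 (fun i => a2 (v i))): b3c1 => H1.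
move/(sat2_lim phi b2 (fun _ => d)): b3d => H2.
have [i [{}H1 {}H2]] := omega_ex (omegaI H1 H2).
have [b1 b1E] := tuple_lim_surj (b2 i).
rewrite b1E in H1 H2.
move/(sat2_lim phi b1 (fun _ => a1 (v i))): H1 => H1.
move/(sat2_lim phi b1 (fun j => a1 (u j))): H2 => H2.
have [j [ij [{}H1 {}H2]]] := omega_ex (omegaI (omega_eventually i) (omegaI H1 H2)).
have [b0 b0E] := tuple_lim_surj (b1 j).
rewrite b0E in H1 H2.
move/(sat2_lim phi b0 (fun _ => a (v i))): H1 => H1.
move/(sat2_lim phi b0 (fun _ => a (u j))): H2 => H2.
have [k [{}H1 {}H2]] := omega_ex (omegaI H1 H2).
have [xi vi pre] := sib i j ij.
by apply: (incons xi (u j) pre); exists (b0 k); rewrite -vi.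
Qed.

(* In the [i]-th fibre, the parameter [eta] pairs 0 with [(eta i).+1]. *)
Definition fibrewise_xor (eta : nat -> nat) (x : nat * N) : nat * N :=
  (x.1, N.lxor x.2 (N.of_nat (eta x.1).+1)).

(** The successor in the mask makes it nonzero, and xor with a nonzero mask moves every number. *)
Lemma fibrewise_xor_neq eta x : fibrewise_xor eta x <> x.
Proof.
case: x => i x [] e; have := N.lxor_nilpotent x; rewrite -{2}e -N.lxor_assoc.
by rewrite N.lxor_nilpotent N.lxor_0_l.
Qed.

Lemma fibrewise_xorK eta x : fibrewise_xor eta (fibrewise_xor eta x) = x.
Proof. by case: x => i x; rewrite /fibrewise_xor /= N.lxor_assoc N.lxor_nilpotent N.lxor_0_r. Qed.

Theorem not_simple_model_completion (T' : theory) :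
  model_completion Tfeq2 T' -> ~ simple_theory T'.
Proof.
move=> [T'T T_ext _] simple.
(* Every function is a parameter, so the pairings in different fibres can be prescribed
   independently. *)
pose D s : Type := match s with Obj => (nat * N)%type | Par => nat -> nat end.
have D_inh s : inhabited (D s) by case: s; constructor; [exact: (0, N0)|exact: id].
pose p : D Par -> D Obj -> D Obj := fibrewise_xor.
have [TM _] := @involution_structureP D p D_inh fibrewise_xor_neq fibrewise_xorK.
have [M [h [T'M [h_inj hE]]]] := T_ext _ TM; have {}TM := T'T M T'M.
pose n s := if s is Par then 1 else 0; pose m s := if s is Obj then 2 else 0.
pose phi : formula (pair_vars n m) :=
  @E (pair_vars n m) (inl ord0) (inr ord0) (inr ord_max).
(* The length of [nu] selects the fibre and its last entry the prescribed partner of 0; the root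
   uses the default entry 0. *)
pose a (nu : seq nat) : tup M m := fun s => match s return 'I_(m s) -> M s with
  | Obj => fun j => h Obj (size nu, if j == ord0 then N0 else N.of_nat (last 0 nu).+1)
  | Par => fun _ => h Par id
  end.
apply: (simple n m phi); exists M; split=> //; exists a, 2; split=> //.
  (* This [z] uses the same default at the root, and realises the whole branch at once. *)
  move=> eta F; pose z : D Par := fun i => last 0 (mkseq eta i).
  exists (fun s => match s return 'I_(n s) -> M s with
    Par => fun _ => h Par z | Obj => fun _ => h Obj (0, N0) end) => i _.
  by apply/hE; right; rewrite /p /fibrewise_xor /= size_mkseq.
move=> nu [|i [|j [|]]] //= /andP[]; rewrite inE => ij _ _ [b bP].
(* Siblings have the same length, hence concern the same fibre; one parameter would give 0 there two
   distinct partners. *)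
have bE k : k \in [:: i; j] ->
    h Obj (size (rcons nu k), N.of_nat k.+1) = partner (b Par ord0) (h Obj (size (rcons nu k), N0)).
  move=> /bP; rewrite /sat2 /= last_rcons => /(interpE_partner TM)[/h_inj[]//|//].
have := bE i; rewrite !inE eqxx size_rcons => /(_ isT) ei.
have := bE j; rewrite !inE eqxx orbT size_rcons => /(_ isT); rewrite -ei.
by move=> /h_inj[] /SuccNat2Pos.inj ji; rewrite ji eqxx in ij.
Qed.

Theorem theorem5p1 (Tstar : theory) (hTstar : model_completion Tfeq2 Tstar) :
  NSOP1 Tstar /\ ~ simple_theory Tstar.
Proof.
by split; [apply: NSOP1_model_completion|apply: not_simple_model_completion].
Qed.
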